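(* Let $P$ be a TRAP and let $\Phi_P:\mathrm{solCGr}(P)\to P$ be the canonical TRAP morphism; $\Phi_P(G)$ is called the $P$-amplitude associated with $G$. The $P$-amplitude associated with a horizontal concatenation of graphs is the horizontal concatenation of their $P$-amplitudes: for any $G_1,G_2\in\mathrm{solCGr}(P)$, $$\Phi_P(G_1*G_2)=\Phi_P(G_1)*\Phi_P(G_2),$$ and the same holds for the vertical concatenation: if $G_1\circ G_2$ exists, then $$\Phi_P(G_1\circ G_2)=\Phi_P(G_1)\circ_P\Phi_P(G_2),$$ with $\circ_P$ the vertical concatenation of $P$.
   Context: Notation: $\mathbb{N}_0=\{0,1,2,\dots\}$, $[k]=\{1,\dots,k\}$, $\mathfrak S_k$ is the symmetric group on $[k]$. TRAP. A TRAP is a family $P=(P(k,l))_{k,l\ge 0}$ of sets with: (1) for all $k,l\in\mathbb N_0$, a left action of $\mathfrak S_l$ and a right action of $\mathfrak S_k$ on $P(k,l)$ which commute. (2) Maps $*:P(k,l)\times P(k',l')\to P(k+k',l+l')$ (horizontal concatenation) such that: $*$ is associative; there is $I_0\in P(0,0)$ with $I_0*p=p*I_0=p$; $(\sigma\cdot p\cdot\tau)*(\sigma'\cdot p'\cdot\tau')=(\sigma\otimes\sigma')\cdot(p*p')\cdot(\tau\otimes\tau')$, where for $\alpha\in\mathfrak S_m,\beta\in\mathfrak S_n$, $(\alpha\otimes\beta)(i)=\alpha(i)$ if $i\le m$ and $\beta(i-m)+m$ if $i>m$; and $c_{l,l'}\cdot(p*p')=(p'*p)\cdot c_{k,k'}$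 for $p\in P(k,l)$, $p'\in P(k',l')$, where $c_{m,n}\in\mathfrak S_{m+n}$, $c_{m,n}(i)=i+n$ if $i\le m$ and $i-m$ if $i>m$. (3) For $k,l\ge1$, $i\in[k]$, $j\in[l]$, maps $t_{i,j}:P(k,l)\to P(k-1,l-1)$ (partial trace maps) such that: (a) for $k,l\ge2$, $i\in[k]$, $j\in[l]$, $i'\in[k-1]$, $j'\in[l-1]$: $t_{i',j'}\circ t_{i,j}$ equals $t_{i-1,j-1}\circ t_{i',j'}$ if $i'<i,j'<j$; $t_{i,j-1}\circ t_{i'+1,j'}$ if $i'\ge i,j'<j$; $t_{i-1,j}\circ t_{i',j'+1}$ if $i'<i,j'\ge j$; $t_{i,j}\circ t_{i'+1,j'+1}$ if $i'\ge i,j'\ge j$. (b) $t_{i,j}(\sigma\cdot p\cdot\tau)=\sigma_j\cdot t_{\tau(i),\sigma^{-1}(j)}(p)\cdot\tau_{\tau(i)}$, where for $\alpha\in\mathfrak S_n$ and $q\in[n]$, $\alpha_q\in\mathfrak S_{n-1}$ is the permutation whose word is obtained from the word $\alpha(1)\dots\alpha(n)$ by deleting the letter $q$ and subtracting $1$ from all letters $>q$. (c) for $p\in P(k,l)$, $p'\in P(k',l')$ ($k,l,k',l'\ge0$), $i\in[k+k']$, $j\in[l+l']$: $t_{i,j}(p*p')=t_{i,j}(p)*p'$ if $i\le k,j\le l$, and $t_{i,j}(p*p')=p*t_{i-k,j-l}(p')$ if $i>k,j>l$. A morphism of TRAPs $\phi:P\to Q$ is a family of maps $P(k,l)\to Q(k,l)$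 commuting with the symmetric group actions, with $\phi(I_0)=I_0$, $\phi(p*q)=\phi(p)*\phi(q)$ and $\phi\circ t_{i,j}=t_{i,j}\circ\phi$. The vertical concatenation in a TRAP $P$ is defined for $p\in P(k,l)$, $q\in P(l,m)$ by $q\circ_P p=t_{k+1,1}\circ\cdots\circ t_{k+l-1,l-1}\circ t_{k+l,l}(p*q)\in P(k,m)$. Solar graphs. A solar corolla ordered graph decorated by $P$ consists of finite sets $V(G)$ (vertices), $E(G)$ (internal edges), $I(G)$ (input edges), $O(G)$ (output edges), a source map $s:E(G)\sqcup O(G)\to V(G)$, a target map $t:E(G)\sqcup I(G)\to V(G)$, bijections $\alpha:I(G)\to[i(G)]$, $\beta:O(G)\to[o(G)]$ with $i(G)=|I(G)|$, $o(G)=|O(G)|$, for each vertex $v$ a total order on its set $t^{-1}(v)$ of incoming edges and on its set $s^{-1}(v)$ of outgoing edges, and a decoration $d_G(v)\in P(|t^{-1}(v)|,|s^{-1}(v)|)$. $\mathrm{solCGr}(P)(k,l)$ is the set of isomorphism classes of such graphs with $i(G)=k$, $o(G)=l$. It is a TRAP: $\tau\cdot G\cdot\sigma$ is $G$ with $\alpha,\beta$ replaced by $\sigma^{-1}\circ\alpha,\tau\circ\beta$; $G*G'$ is the disjoint union with input (output) labels of $G'$ shifted by $i(G)$ (by $o(G)$); $t_{i,j}(G)$ is obtained by replacing the $i$-th input edge $e$ and the $j$-th output edge $f$ by one internal edge from $s(f)$ to $t(e)$ (keeping the position of $f$ among outgoing edges of $s(f)$ and of $e$ among incoming edges of $t(e)$)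 and decreasing by $1$ input labels $>i$ and output labels $>j$. $G_1\circ G_2$ exists when $o(G_2)=i(G_1)$; it is the vertical concatenation in this TRAP, i.e. the graph obtained by gluing the $r$-th output edge of $G_2$ to the $r$-th input edge of $G_1$ for all $r$. $\Phi_P:\mathrm{solCGr}(P)\to P$ is the unique TRAP morphism sending, for each $p\in P(k,l)$, the graph with one vertex decorated by $p$, with $k$ input edges and $l$ output edges ordered at the vertex according to their indices, to $p$. *)

(* Defs.v *)
From mathcomp Require Import all_boot all_fingroup.
From mathcomp Require Import zify boolp.

Set Implicit Arguments.
Unset Strict Implicit.
Unset Printing Implicit Defensive.

(* Indices are 0-based: [k] = {1, ..., k} is encoded as 'I_k, so that a formula
   about i in [k] becomes the formula about i - 1 in 'I_k. *)

(* P(k, l) and P(k', l') with k = k', l = l' provable but not convertible are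
   related by the transport castT. *)
Section Cast.
Variable P : nat -> nat -> Type.

Definition castT k k' l l' (ek : k = k') (el : l = l') (x : P k l) : P k' l' :=
  eq_rect l (P k') (eq_rect k (P^~ l) x k' ek) l' el.

Definition same k l k' l' (x : P k l) (y : P k' l') : Prop :=
  exists (ek : k = k') (el : l = l'), castT ek el x = y.

Lemma castT_id k l (ek : k = k) (el : l = l) (x : P k l) : castT ek el x = x.
Proof. by rewrite (eq_irrelevance ek erefl) (eq_irrelevance el erefl). Qed.

Lemma same_refl k l (x : P k l) : same x x.
Proof. by exists erefl, erefl. Qed.

Lemma same_sym k l k' l' (x : P k l) (y : P k' l') : same x y -> same y x.
Proof. by case=> ek [el <-]; subst; exists erefl, erefl. Qed.

Lemma same_trans k l k1 l1 k2 l2 (x : P k l) (y : P k1 l1) (z : P k2 l2) :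
  same x y -> same y z -> same x z.
Proof. by case=> ek [el <-]; subst. Qed.

Lemma same_castr k l k' l' (ek : k = k') (el : l = l') (x : P k l) :
  same x (castT ek el x).
Proof. by exists ek, el. Qed.

Lemma same_castl k l k' l' (ek : k = k') (el : l = l') (x : P k l) :
  same (castT ek el x) x.
Proof. exact/same_sym/same_castr. Qed.

End Cast.

(* In {perm T} the product s * t applies s first; pcomp s t is s o t. *)
Definition pcomp n (s t : 'S_n) : 'S_n := (t * s)%g.

Lemma pcompE n (s t : 'S_n) i : pcomp s t i = s (t i).
Proof. exact: permM. Qed.

Lemma split_lshift m n (i : 'I_m) : split (lshift n i) = inl i.
Proof. exact: (unsplitK (inl i)). Qed.

Lemma split_rshift m n (i : 'I_n) : split (rshift m i) = inr i.
Proof. exact: (unsplitK (inr i)). Qed.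

Definition tens_fun m n (s : 'S_m) (t : 'S_n) (i : 'I_(m + n)) : 'I_(m + n) :=
  match split i with
  | inl a => lshift n (s a)
  | inr b => rshift m (t b)
  end.

Lemma tens_fun_inj m n (s : 'S_m) (t : 'S_n) : injective (tens_fun s t).
Proof.
apply: (@can_inj _ _ _ (tens_fun s^-1 t^-1)) => i; rewrite /tens_fun.
rewrite -[RHS]splitK; case: (split i) => a /=.
  by rewrite split_lshift permK.
by rewrite split_rshift permK.
Qed.

Definition tens_perm m n (s : 'S_m) (t : 'S_n) : 'S_(m + n) :=
  perm (@tens_fun_inj m n s t).

Definition swap_fun m n (i : 'I_(m + n)) : 'I_(m + n) :=
  cast_ord (addnC n m)
    match split i with
    | inl a => rshift n a
    | inr b => lshift m b
    end.

Lemma swap_fun_inj m n : injective (@swap_fun m n).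
Proof.
apply: (@can_inj _ _ _ (fun i => match split (cast_ord (addnC m n) i) with
  | inl b => rshift m b | inr a => lshift n a end)) => i; rewrite /swap_fun.
rewrite cast_ord_comp cast_ord_id -[RHS]splitK; case: (split i) => a /=.
  by rewrite split_rshift.
by rewrite split_lshift.
Qed.

Definition swap_perm m n : 'S_(m + n) := perm (@swap_fun_inj m n).

(* The word of s with its letter q deleted has its r-th letter at position
   lift (s^-1 q) r of s; subtracting 1 from the letters > q is unlift q. *)
Lemma del_perm_neq n (q : 'I_n.+1) (s : 'S_n.+1) (r : 'I_n) :
  q != s (lift ((s^-1)%g q) r).
Proof. by rewrite -(inj_eq (@perm_inj _ (s^-1)%g)) permK neq_lift. Qed.

Definition del_fun n (q : 'I_n.+1) (s : 'S_n.+1) (r : 'I_n) : 'I_n :=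
  s2val (unlift_some (del_perm_neq q s r)).

Lemma lift_del_fun n (q : 'I_n.+1) (s : 'S_n.+1) (r : 'I_n) :
  lift q (del_fun q s r) = s (lift ((s^-1)%g q) r).
Proof. by rewrite -(s2valP (unlift_some (del_perm_neq q s r))). Qed.

Lemma del_fun_inj n (q : 'I_n.+1) (s : 'S_n.+1) : injective (del_fun q s).
Proof.
move=> r r' /(congr1 (lift q)); rewrite !lift_del_fun => /perm_inj.
exact: lift_inj.
Qed.

Definition del_perm n (q : 'I_n.+1) (s : 'S_n.+1) : 'S_n :=
  perm (@del_fun_inj n q s).

Record trap := Trap {
  tcar :> nat -> nat -> Type;
  lact : forall k l, 'S_l -> tcar k l -> tcar k l;
  ract : forall k l, tcar k l -> 'S_k -> tcar k l;
  hcat : forall k l k' l', tcar k l -> tcar k' l' -> tcar (k + k') (l + l');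
  hone : tcar 0 0;
  ptrace : forall k l, 'I_k.+1 -> 'I_l.+1 -> tcar k.+1 l.+1 -> tcar k l;
  lact1 : forall k l (p : tcar k l), lact 1%g p = p;
  lactM : forall k l (s s' : 'S_l) (p : tcar k l),
    lact s (lact s' p) = lact (pcomp s s') p;
  ract1 : forall k l (p : tcar k l), ract p 1%g = p;
  ractM : forall k l (p : tcar k l) (t t' : 'S_k),
    ract (ract p t) t' = ract p (pcomp t t');
  lractC : forall k l (s : 'S_l) (p : tcar k l) (t : 'S_k),
    ract (lact s p) t = lact s (ract p t);
  hcatA : forall k l k' l' k'' l''
      (p : tcar k l) (p' : tcar k' l') (p'' : tcar k'' l''),
    castT (addnA k k' k'') (addnA l l' l'') (hcat p (hcat p' p''))
      = hcat (hcat p p') p'';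
  hcat1l : forall k l (p : tcar k l),
    castT (add0n k) (add0n l) (hcat hone p) = p;
  hcat1r : forall k l (p : tcar k l),
    castT (addn0 k) (addn0 l) (hcat p hone) = p;
  hcat_act : forall k l k' l' (s : 'S_l) (p : tcar k l) (t : 'S_k)
      (s' : 'S_l') (p' : tcar k' l') (t' : 'S_k'),
    hcat (ract (lact s p) t) (ract (lact s' p') t')
      = ract (lact (tens_perm s s') (hcat p p')) (tens_perm t t');
  hcatC : forall k l k' l' (p : tcar k l) (p' : tcar k' l'),
    lact (swap_perm l l') (hcat p p')
      = ract (castT (addnC k' k) (addnC l' l) (hcat p' p)) (swap_perm k k');
  ptraceC_ltlt : forall k l (i : 'I_k.+2) (j : 'I_l.+2)
      (i' : 'I_k.+1) (j' : 'I_l.+1) (p : tcar k.+2 l.+2),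
    i' < i -> j' < j ->
    ptrace i' j' (ptrace i j p)
      = ptrace (inord i.-1) (inord j.-1) (ptrace (inord i') (inord j') p);
  ptraceC_gelt : forall k l (i : 'I_k.+2) (j : 'I_l.+2)
      (i' : 'I_k.+1) (j' : 'I_l.+1) (p : tcar k.+2 l.+2),
    i <= i' -> j' < j ->
    ptrace i' j' (ptrace i j p)
      = ptrace (inord i) (inord j.-1) (ptrace (inord i'.+1) (inord j') p);
  ptraceC_ltge : forall k l (i : 'I_k.+2) (j : 'I_l.+2)
      (i' : 'I_k.+1) (j' : 'I_l.+1) (p : tcar k.+2 l.+2),
    i' < i -> j <= j' ->
    ptrace i' j' (ptrace i j p)
      = ptrace (inord i.-1) (inord j) (ptrace (inord i') (inord j'.+1) p);
  ptraceC_gege : forall k l (i : 'I_k.+2) (j : 'I_l.+2)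
      (i' : 'I_k.+1) (j' : 'I_l.+1) (p : tcar k.+2 l.+2),
    i <= i' -> j <= j' ->
    ptrace i' j' (ptrace i j p)
      = ptrace (inord i) (inord j) (ptrace (inord i'.+1) (inord j'.+1) p);
  ptrace_act : forall k l (i : 'I_k.+1) (j : 'I_l.+1)
      (s : 'S_l.+1) (p : tcar k.+1 l.+1) (t : 'S_k.+1),
    ptrace i j (ract (lact s p) t)
      = ract (lact (del_perm j s) (ptrace (t i) ((s^-1)%g j) p))
             (del_perm (t i) t);
  ptrace_hcatl : forall k l k' l' (p : tcar k.+1 l.+1) (p' : tcar k' l')
      (i : 'I_k.+1) (j : 'I_l.+1),
    ptrace (lshift k' i) (lshift l' j) (hcat p p') = hcat (ptrace i j p) p';
  ptrace_hcatr : forall k l k' l' (p : tcar k l) (p' : tcar k'.+1 l'.+1)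
      (i : 'I_k'.+1) (j : 'I_l'.+1),
    ptrace (cast_ord (addnS k k') (rshift k i))
           (cast_ord (addnS l l') (rshift l j))
           (castT (addnS k k') (addnS l l') (hcat p p'))
      = hcat p (ptrace i j p')
}.

Arguments hone {_}.

Record trap_morphism (P Q : trap) := TrapMorphism {
  tmap :> forall k l, P k l -> Q k l;
  tmap_lact : forall k l (s : 'S_l) (p : P k l),
    tmap (lact s p) = lact s (tmap p);
  tmap_ract : forall k l (p : P k l) (t : 'S_k),
    tmap (ract p t) = ract (tmap p) t;
  tmap_one : tmap hone = hone;
  tmap_hcat : forall k l k' l' (p : P k l) (q : P k' l'),
    tmap (hcat p q) = hcat (tmap p) (tmap q);
  tmap_ptrace : forall k l (i : 'I_k.+1) (j : 'I_l.+1) (p : P k.+1 l.+1),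
    tmap (ptrace i j p) = ptrace i j (tmap p)
}.

(* With 1-based indices: vtrace r = t_(k+1,1) o ... o t_(k+r,r). *)
Fixpoint vtrace (P : trap) k m r : P (k + r) (r + m) -> P k m :=
  match r with
  | 0 => fun x => castT (addn0 k) (add0n m) x
  | r'.+1 => fun x =>
      vtrace (ptrace (inord (k + r')) (inord r')
                     (castT (addnS k r') (addSn r' m) x))
  end.

Definition vcat (P : trap) k l m (q : P l m) (p : P k l) : P k m :=
  vtrace (hcat p q).

Definition total_order_on (T : Type) (D : {pred T}) (r : rel T) : Prop :=
  [/\ {in D &, total r}, {in D &, antisymmetric r} & {in D & &, transitive r}].

(* A side gathers either the incoming or the outgoing data of a graph with
   vertices V and internal edges E: the external edges (I(G) or O(G)), the
   target or source map, the labelling (alpha or beta), and a relation whose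
   restriction to the edges attached to any given vertex is the total order at
   that vertex.  Its values on edges attached to distinct vertices carry no
   information: side_iso ignores them. *)
Record side (V E : finType) (n : nat) := Side {
  ext : finType;
  att : E + ext -> V;
  lab : ext -> 'I_n;
  lab_bij : bijective lab;
  ord : rel (E + ext);
  ordP : forall v, total_order_on [pred h | att h == v] ord
}.

Arguments att {V E n} _ _.
Arguments lab {V E n} _ _.
Arguments ord {V E n} _ _ _.

Definition deg (V E : finType) n (S : side V E n) (v : V) : nat :=
  #|[pred h | att S h == v]|.

Record graph (P : nat -> nat -> Type) (k l : nat) := Graph {
  vert : finType;
  edge : finType;
  ins : side vert edge k;
  outs : side vert edge l;
  dec : forall v, P (deg ins v) (deg outs v)
}.

Arguments dec {P k l} _ _.

Definition hmap (A B A' B' : Type) (f : A -> A') (g : B -> B') (h : A + B) :=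
  match h with inl a => inl (f a) | inr b => inr (g b) end.

Definition side_iso (V E V' E' : finType) n (fV : V -> V') (fE : E -> E')
    (S : side V E n) (S' : side V' E' n) : Prop :=
  exists fX : ext S -> ext S',
    [/\ bijective fX,
        forall x, lab S' (fX x) = lab S x,
        forall h, att S' (hmap fE fX h) = fV (att S h)
      & forall h1 h2, att S h1 = att S h2 ->
          ord S' (hmap fE fX h1) (hmap fE fX h2) = ord S h1 h2].

Definition graph_iso (P : nat -> nat -> Type) k l (G G' : graph P k l) : Prop :=
  exists (fV : vert G -> vert G') (fE : edge G -> edge G'),
    [/\ bijective fV, bijective fE,
        side_iso fV fE (ins G) (ins G'),
        side_iso fV fE (outs G) (outs G')
      & forall v, same (dec G v) (dec G' (fV v))].

Definition graph_class (P : nat -> nat -> Type) k l : Type :=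
  {C : graph P k l -> Prop | exists G, C = graph_iso G}.

Definition cls (P : nat -> nat -> Type) k l (G : graph P k l) :
  graph_class P k l := exist _ (graph_iso G) (ex_intro _ G erefl).

Definition rep (P : nat -> nat -> Type) k l (C : graph_class P k l) :
  graph P k l := projT1 (cid (proj2_sig C)).

Section SideOps.

Lemma inj_surj_bij (T : finType) (T' : eqType) (f : T -> T') :
  injective f -> (forall y, exists x, f x == y) -> bijective f.
Proof.
move=> fI fS; exists (fun y => xchoose (fS y)) => [x|y].
  by apply: fI; apply/eqP; exact: (xchooseP (fS _)).
by apply/eqP; exact: (xchooseP (fS _)).
Qed.

Lemma total_order_pull (T T' : Type) (h : T' -> T) (D : {pred T})
    (D' : {pred T'}) (r : rel T) : injective h ->
  (forall x, x \in D' -> h x \in D) ->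
  total_order_on D r -> total_order_on D' (relpre h r).
Proof.
move=> hI hD [tot asym trans]; split=> [x y Dx Dy|x y Dx Dy /=|y x z Dy Dx Dz].
- by apply: tot; apply: hD.
- by move=> e; apply: hI; apply: asym (hD _ Dx) (hD _ Dy) e.
- by apply: trans; apply: hD.
Qed.

Lemma card_pull (T T' : finType) (h : T' -> T) (D : {pred T}) (D' : {pred T'}) :
  injective h -> (forall x, (x \in D') = (h x \in D)) ->
  (forall y, y \in D -> exists x, y = h x) -> #|D'| = #|D|.
Proof.
move=> hI hD hS; rewrite -(card_image hI); apply: eq_card => y.
apply/imageP/idP => [[x Dx ->]|Dy]; first by rewrite -hD.
by have [x e] := hS _ Dy; exists x => //; rewrite hD -e.
Qed.

Lemma lab_inj (V E : finType) n (S : side V E n) : injective (lab S).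
Proof. exact: bij_inj (lab_bij S). Qed.

Lemma lab_surj (V E : finType) n (S : side V E n) i : exists x, lab S x == i.
Proof. by have [g _ gK] := lab_bij S; exists (g i); rewrite gK. Qed.

Definition relabel (V E : finType) n n' (f : 'I_n -> 'I_n') (fB : bijective f)
    (S : side V E n) : side V E n' :=
  Side (bij_comp fB (lab_bij S)) (@ordP _ _ _ S).

Definition half_split A A' B B' (h : (A + A') + (B + B')) : (A + B) + (A' + B') :=
  match h with
  | inl (inl a) => inl (inl a)
  | inl (inr a') => inr (inl a')
  | inr (inl b) => inl (inr b)
  | inr (inr b') => inr (inr b')
  end.

Lemma half_split_inj A A' B B' : injective (@half_split A A' B B').
Proof. by case=> [[a|a]|[b|b]] [[c|c]|[d|d]] //= [->]. Qed.

Definition rel_sum A B (r : rel A) (s : rel B) : rel (A + B) := fun x y =>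
  match x, y with
  | inl a, inl b => r a b
  | inr a, inr b => s a b
  | _, _ => false
  end.

Section Cat.
Variables (V E V' E' : finType) (n n' : nat) (S : side V E n) (S' : side V' E' n').

Definition cat_att (h : (E + E') + (ext S + ext S')) : V + V' :=
  hmap (att S) (att S') (half_split h).

Definition cat_lab (x : ext S + ext S') : 'I_(n + n') :=
  match x with
  | inl x => lshift n' (lab S x)
  | inr x => rshift n (lab S' x)
  end.

Lemma cat_lab_bij : bijective cat_lab.
Proof.
apply: inj_surj_bij => [[x|x] [y|y] /=|i].
- by move/lshift_inj/lab_inj->.
- by move=> e; have := eq_lrshift (lab S x) (lab S' y); rewrite e eqxx.
- by move=> e; have := eq_rlshift (lab S' x) (lab S y); rewrite e eqxx.
- by move/rshift_inj/lab_inj->.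
case: (split_ordP i) => j ->.
  by have [x /eqP<-] := lab_surj S j; exists (inl x).
by have [x /eqP<-] := lab_surj S' j; exists (inr x).
Qed.

Definition cat_ord : rel ((E + E') + (ext S + ext S')) :=
  relpre (@half_split _ _ _ _) (rel_sum (ord S) (ord S')).

Lemma cat_ordP v : total_order_on [pred h | cat_att h == v] cat_ord.
Proof.
apply: (total_order_pull (D := [pred h | hmap (att S) (att S') h == v])).
- exact: half_split_inj.
- by [].
case: v => v.
  have [tot asym trans] := @ordP _ _ _ S v; split.
  - by case=> x [] y //; apply: tot.
  - by case=> x [] y // Dx Dy /= e; congr (_ _); apply: asym e.
  - by case=> x [] y [] z //; apply: trans.
have [tot asym trans] := @ordP _ _ _ S' v; split.
- by case=> x [] y //; apply: tot.
- by case=> x [] y // Dx Dy /= e; congr (_ _); apply: asym e.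
- by case=> x [] y [] z //; apply: trans.
Qed.

Definition side_cat : side (V + V')%type (E + E')%type (n + n') :=
  Side cat_lab_bij cat_ordP.

Lemma deg_catl v : deg side_cat (inl v) = deg S v.
Proof.
apply/esym/(card_pull (h := fun h => match h with
  | inl e => inl (inl e) | inr x => inr (inl x) end)).
- by case=> x [] y //= [->].
- by case.
- by case=> [[e|e]|[x|x]] //= _; [exists (inl e) | exists (inr x)].
Qed.

Lemma deg_catr v : deg side_cat (inr v) = deg S' v.
Proof.
apply/esym/(card_pull (h := fun h => match h with
  | inl e => inl (inr e) | inr x => inr (inr x) end)).
- by case=> x [] y //= [->].
- by case.
- by case=> [[e|e]|[x|x]] //= _; [exists (inl e) | exists (inr x)].
Qed.

End Cat.

Section Tr.
Variables (V E : finType) (n : nat) (S : side V E n.+1) (i : 'I_n.+1).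

Definition ext_at : ext S := xchoose (lab_surj S i).

Lemma lab_ext_at : lab S ext_at = i.
Proof. exact/eqP/(xchooseP (lab_surj S i)). Qed.

Definition tr_ext : finType := {x : ext S | i != lab S x}.

(* The new internal edge None takes the place of the external edge labelled i. *)
Definition tr_half (h : option E + tr_ext) : E + ext S :=
  match h with
  | inl None => inr ext_at
  | inl (Some e) => inl e
  | inr x => inr (val x)
  end.

Lemma tr_half_inj : injective tr_half.
Proof.
case=> [[e|]|x] [[e'|]|x'] //=.
- by case=> ->.
- by case=> e; have := valP x'; rewrite /= -e lab_ext_at eqxx.
- by case=> e; have := valP x; rewrite /= e lab_ext_at eqxx.
- by case=> /val_inj->.
Qed.

Lemma tr_half_surj h : exists h', h = tr_half h'.
Proof.
case: h => [e|x]; first by exists (inl (Some e)).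
have [e|ne] := eqVneq i (lab S x); last by exists (inr (exist _ x ne)).
by exists (inl None); congr inr; apply: lab_inj; rewrite lab_ext_at e.
Qed.

Definition tr_lab (x : tr_ext) : 'I_n := s2val (unlift_some (valP x)).

Lemma lift_tr_lab x : lift i (tr_lab x) = lab S (val x).
Proof. by rewrite -(s2valP (unlift_some (valP x))). Qed.

Lemma tr_lab_bij : bijective tr_lab.
Proof.
apply: inj_surj_bij => [x y /(congr1 (lift i))|j].
  by rewrite !lift_tr_lab => /lab_inj/val_inj.
have [x /eqP e] := lab_surj S (lift i j).
have ne : i != lab S x by rewrite e neq_lift.
by exists (exist _ x ne); rewrite -(inj_eq (@lift_inj _ i)) lift_tr_lab /= e.
Qed.

Lemma tr_ordP v :
  total_order_on [pred h | att S (tr_half h) == v] (relpre tr_half (ord S)).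
Proof.
by apply: (total_order_pull tr_half_inj) (@ordP _ _ _ S v).
Qed.

Definition side_tr : side V (option E) n := Side tr_lab_bij tr_ordP.

Lemma deg_tr v : deg side_tr v = deg S v.
Proof.
apply: (card_pull tr_half_inj) => // h _; exact: tr_half_surj.
Qed.

End Tr.

End SideOps.

Lemma perm_bij n (s : 'S_n) : bijective s.
Proof. by exists (s^-1)%g; [apply: permK | apply: permKV]. Qed.

Section GraphOps.
Variable P : nat -> nat -> Type.

Definition graph_lact k l (s : 'S_l) (G : graph P k l) : graph P k l :=
  @Graph P k l (vert G) (edge G) (ins G) (relabel (perm_bij s) (outs G))
    (dec G).

Definition graph_ract k l (G : graph P k l) (t : 'S_k) : graph P k l :=
  @Graph P k l (vert G) (edge G) (relabel (perm_bij (t^-1)%g) (ins G)) (outs G)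
    (dec G).

Definition graph_cat k l k' l' (G : graph P k l) (G' : graph P k' l') :
    graph P (k + k') (l + l') :=
  @Graph P _ _ (vert G + vert G')%type (edge G + edge G')%type
    (side_cat (ins G) (ins G')) (side_cat (outs G) (outs G'))
    (fun v => match v with
      | inl v => castT (esym (deg_catl _ _ _)) (esym (deg_catl _ _ _)) (dec G v)
      | inr v => castT (esym (deg_catr _ _ _)) (esym (deg_catr _ _ _)) (dec G' v)
      end).

Definition graph_tr k l (i : 'I_k.+1) (j : 'I_l.+1) (G : graph P k.+1 l.+1) :
    graph P k l :=
  @Graph P k l (vert G) (option (edge G))
    (side_tr (ins G) i) (side_tr (outs G) j)
    (fun v => castT (esym (deg_tr _ _ _)) (esym (deg_tr _ _ _)) (dec G v)).

Definition void_lab (x : void) : 'I_0 := match x with end.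

Lemma void_lab_bij : bijective void_lab.
Proof. by exists (fun i : 'I_0 => match notF (ltn_ord i) with end) => - []. Qed.

Definition void_att (h : void + void) : void :=
  match h with inl e => e | inr x => x end.

Lemma void_att_ordP v :
  total_order_on [pred h | void_att h == v] (fun _ _ => false).
Proof. by case: v. Qed.

Definition void_side : side void void 0 := Side void_lab_bij void_att_ordP.

Definition graph_one : graph P 0 0 :=
  @Graph P 0 0 void void void_side void_side
    (fun v => match v with end).

Section Corolla.

Definition cor_ord n (x y : void + 'I_n) : bool :=
  match x, y with inr i, inr j => i <= j | _, _ => false end.

Lemma cor_ordP n v :
  total_order_on [pred h : void + 'I_n | tt == v] (@cor_ord n).
Proof.
split.
- by case=> [[]|x] [[]|y] _ _; apply: leq_total.
- case=> [[]|x] [[]|y] _ _ /= le; congr inr.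
  by apply/val_inj/eqP; rewrite eqn_leq.
- by case=> [[]|y] [[]|x] [[]|z] _ _ _; apply: leq_trans.
Qed.

Definition cor_side n : side unit void n :=
  @Side _ _ n 'I_n (fun=> tt) id (Bijective (frefl id) (frefl id))
    (@cor_ord n) (@cor_ordP n).

Lemma deg_cor n v : deg (cor_side n) v = n.
Proof.
rewrite -[RHS]card_ord /deg; apply/esym/(card_pull (h := inr)).
- by move=> x y [].
- by case: v.
- by case=> [[]|x] _; exists x.
Qed.

Definition graph_corolla k l (p : P k l) : graph P k l :=
  @Graph P k l unit void (cor_side k) (cor_side l)
    (fun v => castT (esym (deg_cor k v)) (esym (deg_cor l v)) p).

End Corolla.
End GraphOps.

Section Sim.

(* sim is side_iso across numbers of external edges which are equal without
   being convertible; labels are compared as natural numbers. *)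
Definition sim (V E V' E' : finType) n n' (fV : V -> V') (fE : E -> E')
    (S : side V E n) (S' : side V' E' n') : Prop :=
  n = n' /\ exists fX : ext S -> ext S',
    [/\ forall x, lab S' (fX x) = lab S x :> nat,
        forall h, att S' (hmap fE fX h) = fV (att S h)
      & forall h1 h2, att S h1 = att S h2 ->
          ord S' (hmap fE fX h1) (hmap fE fX h2) = ord S h1 h2].

Definition hrel (V E V' E' : finType) n n' (fE : E -> E')
    (S : side V E n) (S' : side V' E' n') (h : E + ext S) (h' : E' + ext S') :=
  match h, h' with
  | inl e, inl e' => e' = fE e
  | inr x, inr x' => lab S x = lab S' x' :> nat
  | _, _ => False
  end.

Lemma simH (V E V' E' : finType) n n' (fV : V -> V') (fE : E -> E')
    (S : side V E n) (S' : side V' E' n') : n = n' ->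
  (forall h h', hrel fE h h' -> att S' h' = fV (att S h)) ->
  (forall h1 h1' h2 h2', hrel fE h1 h1' -> hrel fE h2 h2' ->
     att S h1 = att S h2 -> ord S' h1' h2' = ord S h1 h2) ->
  sim fV fE S S'.
Proof.
move=> enn attH ordH; split=> //; subst n'.
pose fX x := xchoose (lab_surj S' (lab S x)).
have fXE x : lab S' (fX x) = lab S x.
  exact/eqP/(xchooseP (lab_surj S' (lab S x))).
have hR h : hrel fE h (hmap fE fX h) by case: h => //= x; rewrite fXE.
exists fX; split=> [x|h|h1 h2 e]; first by rewrite fXE.
- exact: attH.
- exact: ordH.
Qed.

Lemma simE (V E V' E' : finType) n n' (fV : V -> V') (fE : E -> E')
    (S : side V E n) (S' : side V' E' n') : sim fV fE S S' ->
  [/\ n = n',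
      forall h h', hrel fE h h' -> att S' h' = fV (att S h)
    & forall h1 h1' h2 h2', hrel fE h1 h1' -> hrel fE h2 h2' ->
        att S h1 = att S h2 -> ord S' h1' h2' = ord S h1 h2].
Proof.
case=> enn [fX [fXE attH ordH]]; subst n'.
have hR h h' : hrel fE h h' -> h' = hmap fE fX h.
  case: h h' => [a|x] [a'|x'] //= e; first by rewrite e.
  by congr inr; apply: lab_inj; apply: val_inj; rewrite /= -e fXE.
split=> // [h h' /hR->|h1 h1' h2 h2' /hR-> /hR->]; first exact: attH.
exact: ordH.
Qed.

Lemma side_iso_sim (V E V' E' : finType) n (fV : V -> V') (fE : E -> E')
    (S : side V E n) (S' : side V' E' n) :
  side_iso fV fE S S' <-> sim fV fE S S'.
Proof.
split=> [[fX [_ fXE attH ordH]]|[_ [fX [fXE attH ordH]]]].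
  by split=> //; exists fX; split=> // x; rewrite fXE.
exists fX; split=> // [|x]; last exact/val_inj/fXE.
apply: inj_surj_bij => [x y e|y].
  by apply: (@lab_inj _ _ _ S); apply: val_inj; rewrite /= -!fXE e.
have [x /eqP e] := lab_surj S (lab S' y).
by exists x; apply/eqP/(@lab_inj _ _ _ S')/val_inj; rewrite /= fXE e.
Qed.

Lemma sim_refl (V E : finType) n (S : side V E n) : sim id id S S.
Proof. by split=> //; exists id; split=> // [[]|[?|?] []]. Qed.

Lemma sim_trans (V E V' E' V'' E'' : finType) n n' n''
    (fV : V -> V') (fE : E -> E') (gV : V' -> V'') (gE : E' -> E'')
    (S : side V E n) (S' : side V' E' n') (S'' : side V'' E'' n'') :
  sim fV fE S S' -> sim gV gE S' S'' -> sim (gV \o fV) (gE \o fE) S S''.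
Proof.
case=> e1 [fX [fL fA fO]] [e2 [gX [gL gA gO]]].
split; first exact: etrans e1 e2.
have hm h : hmap (gE \o fE) (gX \o fX) h = hmap gE gX (hmap fE fX h).
  by case: h.
exists (gX \o fX); split=> [x|h|h1 h2 e]; first by rewrite /= gL fL.
- by rewrite hm gA fA.
- by rewrite !hm gO ?fO // !fA e.
Qed.

Lemma sim_sym (V E V' E' : finType) n n' (fV : V -> V') (fE : E -> E')
    (gV : V' -> V) (gE : E' -> E) (S : side V E n) (S' : side V' E' n') :
  cancel fV gV -> cancel gV fV -> cancel gE fE ->
  sim fV fE S S' -> sim gV gE S' S.
Proof.
move=> fVK gVK gEK /simE[enn fA fO].
have hR h h' : hrel gE h' h -> hrel fE h h'.
  by case: h h' => [e|x] [e'|x'] //= ->; rewrite ?gEK.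
apply: simH => // [h' h /hR/fA->|h1' h1 h2' h2 /hR e1 /hR e2].
  by rewrite fVK.
rewrite (fA _ _ e1) (fA _ _ e2) => /(can_inj fVK) e.
by rewrite (fO _ _ _ _ e1 e2).
Qed.

Lemma sim_relabel (V E V' E' : finType) n n' m m' (fV : V -> V') (fE : E -> E')
    (S : side V E n) (S' : side V' E' n')
    (f : 'I_n -> 'I_m) (fB : bijective f) (f' : 'I_n' -> 'I_m')
    (fB' : bijective f') : m = m' ->
  (forall (i : 'I_n) (i' : 'I_n'), i = i' :> nat -> f i = f' i' :> nat) ->
  sim fV fE S S' -> sim fV fE (relabel fB S) (relabel fB' S').
Proof.
move=> emm ff' [enn [fX [fL fA fO]]]; split=> //; exists fX; split=> // x /=.
exact/esym/ff'/esym/fL.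
Qed.

Lemma sim_cat (V1 E1 V1' E1' V2 E2 V2' E2' : finType) n1 n1' n2 n2'
    (fV : V1 -> V1') (fE : E1 -> E1') (gV : V2 -> V2') (gE : E2 -> E2')
    (S1 : side V1 E1 n1) (S1' : side V1' E1' n1')
    (S2 : side V2 E2 n2) (S2' : side V2' E2' n2') :
  sim fV fE S1 S1' -> sim gV gE S2 S2' ->
  sim (hmap fV gV) (hmap fE gE) (side_cat S1 S2) (side_cat S1' S2').
Proof.
case=> e1 [fX [fL fA fO]] [e2 [gX [gL gA gO]]]; subst n1' n2'; split=> //.
exists (hmap fX gX); split=> [[x|x]|h|h1 h2]; rewrite /= ?fL ?gL //.
  case: h => [[e|e]|[x|x]] /=; rewrite /cat_att /=.
  - by rewrite -fA.
  - by rewrite -gA.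
  - by rewrite -fA.
  - by rewrite -gA.
case: h1 h2 => [[e1|e1]|[x1|x1]] [[e2|e2]|[x2|x2]];
  rewrite /cat_att /cat_ord //= => - [] e;
  first [exact: (fO (inl _) (inl _)) | exact: (fO (inl _) (inr _))
    | exact: (fO (inr _) (inl _)) | exact: (fO (inr _) (inr _))
    | exact: (gO (inl _) (inl _)) | exact: (gO (inl _) (inr _))
    | exact: (gO (inr _) (inl _)) | exact: (gO (inr _) (inr _))].
Qed.

Lemma nat_tr_lab (V E : finType) n (S : side V E n.+1) i (x : tr_ext S i) :
  bump i (tr_lab x) = lab S (val x).
Proof. by rewrite -lift_tr_lab. Qed.

Lemma sim_tr (V E V' E' : finType) n n' (fV : V -> V') (fE : E -> E')
    (S : side V E n.+1) (S' : side V' E' n'.+1) (i : 'I_n.+1) (i' : 'I_n'.+1) :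
  i = i' :> nat ->
  sim fV fE S S' -> sim fV (omap fE) (side_tr S i) (side_tr S' i').
Proof.
move=> eii /simE[[enn] fA fO].
have hR (h : option E + ext (side_tr S i)) (h' : option E' + ext (side_tr S' i')) :
    hrel (omap fE) h h' -> hrel fE (tr_half h) (tr_half h').
  case: h h' => [[e|]|x] [[e'|]|x'] //=.
  - by case.
  - by rewrite !lab_ext_at.
  - by move=> e; rewrite -!nat_tr_lab eii e.
apply: simH => // [h h' /hR/fA //|h1 h1' h2 h2' /hR e1 /hR e2 e].
exact: fO e1 e2 e.
Qed.

End Sim.

Section Hiso.
Variable P : nat -> nat -> Type.

Definition hiso k l k' l' (G : graph P k l) (G' : graph P k' l') : Prop :=
  exists (fV : vert G -> vert G') (fE : edge G -> edge G'),
    [/\ bijective fV, bijective fE,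
        sim fV fE (ins G) (ins G'),
        sim fV fE (outs G) (outs G')
      & forall v, same (dec G v) (dec G' (fV v))].

Lemma iso_hiso k l (G G' : graph P k l) : graph_iso G G' <-> hiso G G'.
Proof.
by split=> -[fV [fE [? ? /side_iso_sim? /side_iso_sim? ?]]]; exists fV, fE.
Qed.

Lemma hiso_refl k l (G : graph P k l) : hiso G G.
Proof.
exists id, id; split; try exact: sim_refl; try exact: (Bijective (frefl id) (frefl id)).
by move=> v; apply: same_refl.
Qed.

Lemma hiso_sym k l k' l' (G : graph P k l) (G' : graph P k' l') :
  hiso G G' -> hiso G' G.
Proof.
case=> fV [fE [[gV fVK gVK] [gE fEK gEK] si so sd]].
exists gV, gE; split; try by [exists fV | exists fE].
- exact: sim_sym si.
- exact: sim_sym so.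
move=> v; apply: same_sym; apply: same_trans (sd _) _.
by rewrite gVK; apply: same_refl.
Qed.

Lemma hiso_trans k l k' l' k'' l'' (G : graph P k l) (G' : graph P k' l')
    (G'' : graph P k'' l'') : hiso G G' -> hiso G' G'' -> hiso G G''.
Proof.
case=> fV [fE [fVB fEB si so sd]] [gV [gE [gVB gEB ti to td]]].
exists (gV \o fV), (gE \o fE); split; try exact: bij_comp.
- exact: sim_trans si ti.
- exact: sim_trans so to.
- by move=> v; apply: same_trans (sd v) (td _).
Qed.

Lemma hiso_castr k l k' l' (ek : k = k') (el : l = l') (G : graph P k l) :
  hiso G (castT ek el G).
Proof. by subst; apply: hiso_refl. Qed.

Lemma iso_refl k l (G : graph P k l) : graph_iso G G.
Proof. exact/iso_hiso/hiso_refl. Qed.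

Lemma clsE k l (G G' : graph P k l) : hiso G G' -> cls G = cls G'.
Proof.
move=> e; apply: eq_exist; apply/funext => H; apply/propext.
rewrite !iso_hiso; split; last exact: hiso_trans e.
exact: hiso_trans (hiso_sym e).
Qed.

Lemma cls_rep k l (C : graph_class P k l) : cls (rep C) = C.
Proof.
rewrite /rep; case: cid => G /=; case: C => C hC /= e.
by apply: eq_exist; rewrite e.
Qed.

Lemma rep_cls k l (G : graph P k l) : hiso (rep (cls G)) G.
Proof.
by apply/iso_hiso; have /(congr1 sval) /= -> := cls_rep (cls G); apply: iso_refl.
Qed.

Lemma castT_cls k l k' l' (ek : k = k') (el : l = l') (G : graph P k l) :
  castT ek el (cls G) = cls (castT ek el G).
Proof. by subst. Qed.

Lemma hiso_lact k l (s : 'S_l) (G G' : graph P k l) :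
  hiso G G' -> hiso (graph_lact s G) (graph_lact s G').
Proof.
case=> fV [fE [fVB fEB si so sd]]; exists fV, fE; split=> //=.
by apply: sim_relabel so => // i i' /val_inj->.
Qed.

Lemma hiso_ract k l (t : 'S_k) (G G' : graph P k l) :
  hiso G G' -> hiso (graph_ract G t) (graph_ract G' t).
Proof.
case=> fV [fE [fVB fEB si so sd]]; exists fV, fE; split=> //=.
by apply: sim_relabel si => // i i' /val_inj->.
Qed.

Lemma hmap_bij A B A' B' (f : A -> A') (g : B -> B') :
  bijective f -> bijective g -> bijective (hmap f g).
Proof.
case=> f' fK f'K [g' gK g'K].
by exists (hmap f' g') => -[x|x] /=; rewrite ?fK ?f'K ?gK ?g'K.
Qed.

Lemma omap_bij A B (f : A -> B) : bijective f -> bijective (omap f).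
Proof.
by case=> g fK gK; exists (omap g) => -[x|] //=; rewrite ?fK ?gK.
Qed.

Lemma hiso_cat k1 l1 k1' l1' k2 l2 k2' l2'
    (G1 : graph P k1 l1) (G1' : graph P k1' l1')
    (G2 : graph P k2 l2) (G2' : graph P k2' l2') :
  hiso G1 G1' -> hiso G2 G2' -> hiso (graph_cat G1 G2) (graph_cat G1' G2').
Proof.
case=> fV [fE [fVB fEB si so sd]] [gV [gE [gVB gEB ti to td]]].
exists (hmap fV gV), (hmap fE gE); split; try exact: hmap_bij.
- exact: sim_cat.
- exact: sim_cat.
case=> v /=; apply: same_trans (same_castl _ _ _) _.
  by apply: same_trans (sd v) _; apply: same_castr.
by apply: same_trans (td v) _; apply: same_castr.
Qed.

Lemma hiso_tr k l k' l' (i : 'I_k.+1) (j : 'I_l.+1) (i' : 'I_k'.+1)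
    (j' : 'I_l'.+1) (G : graph P k.+1 l.+1) (G' : graph P k'.+1 l'.+1) :
  i = i' :> nat -> j = j' :> nat ->
  hiso G G' -> hiso (graph_tr i j G) (graph_tr i' j' G').
Proof.
move=> ei ej [fV [fE [fVB fEB si so sd]]].
exists fV, (omap fE); split=> //; try exact: omap_bij; try exact: sim_tr.
move=> v /=; apply: same_trans (same_castl _ _ _) _.
by apply: same_trans (sd v) _; apply: same_castr.
Qed.

End Hiso.

Section SideAxioms.

Definition sum_assoc A B C (x : A + (B + C)) : (A + B) + C :=
  match x with
  | inl a => inl (inl a)
  | inr (inl b) => inl (inr b)
  | inr (inr c) => inr c
  end.

Lemma sum_assoc_bij A B C : bijective (@sum_assoc A B C).
Proof.
by exists (fun x => match x with inl (inl a) => inl a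
  | inl (inr b) => inr (inl b) | inr c => inr (inr c) end);
  [case=> [a|[b|c]] | case=> [[a|b]|c]].
Qed.

Definition sum_swap A B (x : A + B) : B + A :=
  match x with inl a => inr a | inr b => inl b end.

Lemma sum_swap_bij A B : bijective (@sum_swap A B).
Proof. by exists (@sum_swap B A); case. Qed.

Definition void_inl A (x : void + A) : A :=
  match x with inl v => match v with end | inr a => a end.

Lemma void_inl_bij A : bijective (@void_inl A).
Proof. by exists inr => // -[[]|x]. Qed.

Definition void_inr A (x : A + void) : A :=
  match x with inr v => match v with end | inl a => a end.

Lemma void_inr_bij A : bijective (@void_inr A).
Proof. by exists inl => // -[x|[]]. Qed.

Lemma sim_catA (V E V' E' V'' E'' : finType) n n' n''
    (S : side V E n) (S' : side V' E' n') (S'' : side V'' E'' n'') :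
  sim (@sum_assoc V V' V'') (@sum_assoc E E' E'')
    (side_cat S (side_cat S' S'')) (side_cat (side_cat S S') S'').
Proof.
split; first exact: addnA.
exists (@sum_assoc _ _ _); split.
- by case=> [x|[x|x]] //=; rewrite addnA.
- by case=> [[e|[e|e]]|[x|[x|x]]].
by case=> [[e|[e|e]]|[x|[x|x]]] [[f|[f|f]]|[y|[y|y]]].
Qed.

Lemma sim_cat1l (V E : finType) n (S : side V E n) :
  sim (@void_inl V) (@void_inl E) (side_cat void_side S) S.
Proof.
split; first exact: add0n.
exists (@void_inl _); split.
- by case=> [[]|x].
- by case=> [[[]|e]|[[]|x]].
by case=> [[[]|e]|[[]|x]] [[[]|f]|[[]|y]].
Qed.

Lemma sim_cat1r (V E : finType) n (S : side V E n) :
  sim (@void_inr V) (@void_inr E) (side_cat S void_side) S.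
Proof.
split; first exact: addn0.
exists (@void_inr _); split.
- by case=> [x|[]].
- by case=> [[e|[]]|[x|[]]].
by case=> [[e|[]]|[x|[]]] [[f|[]]|[y|[]]].
Qed.

Lemma sim_relabel_id (V E : finType) n m (S : side V E n) (S' : side V E m)
    (f : 'I_n -> 'I_n) (fB : bijective f) : f =1 id -> sim id id S S' ->
  sim id id (relabel fB S) S'.
Proof.
move=> f1 [enm [fX [fL fA fO]]]; split=> //; exists fX; split=> // x.
by rewrite fL /= f1.
Qed.

Lemma sim_cat_relabel (V E V' E' : finType) n n'
    (S : side V E n) (S' : side V' E' n')
    (f : 'I_n -> 'I_n) (fB : bijective f) (f' : 'I_n' -> 'I_n')
    (fB' : bijective f') (g : 'I_(n + n') -> 'I_(n + n')) (gB : bijective g) :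
  (forall i, g (lshift n' i) = lshift n' (f i)) ->
  (forall i, g (rshift n i) = rshift n (f' i)) ->
  sim id id (side_cat (relabel fB S) (relabel fB' S'))
            (relabel gB (side_cat S S')).
Proof.
move=> gl gr; split=> //; exists id; split.
- by case=> x /=; rewrite ?gl ?gr.
- by case=> [[e|e]|[x|x]].
by case=> [[e|e]|[x|x]] [[f1|f1]|[y|y]].
Qed.

Lemma sim_catC (V E V' E' : finType) n n'
    (S : side V E n) (S' : side V' E' n')
    (g : 'I_(n + n') -> 'I_(n + n')) (gB : bijective g) :
  g =1 @swap_fun n n' ->
  sim (@sum_swap V V') (@sum_swap E E') (relabel gB (side_cat S S'))
    (side_cat S' S).
Proof.
move=> gE; split; first exact: addnC.
exists (@sum_swap _ _); split.
- by case=> x /=; rewrite gE /swap_fun ?split_lshift ?split_rshift.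
- by case=> [[e|e]|[x|x]].
by case=> [[e|e]|[x|x]] [[f1|f1]|[y|y]].
Qed.

Definition opt_swap A (x : option (option A)) : option (option A) :=
  match x with
  | None => Some None
  | Some None => None
  | Some (Some a) => Some (Some a)
  end.

Lemma opt_swap_bij A : bijective (@opt_swap A).
Proof. by exists (@opt_swap A) => -[[a|]|]. Qed.

Lemma sim_trtr (V E : finType) n (S : side V E n.+2) (i a' : 'I_n.+2)
    (i' a : 'I_n.+1) : bump i i' = a' -> bump a' a = i ->
  sim id (@opt_swap E) (side_tr (side_tr S i) i') (side_tr (side_tr S a') a).
Proof.
move=> e1 e2.
have hR h h' : hrel (@opt_swap E) h h' ->
    tr_half (tr_half (h : option (option E) + ext (side_tr (side_tr S i) i')))
    = tr_half (tr_half (h' : option (option E) + ext (side_tr (side_tr S a') a))).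
  case: h h' => [[[e|]|]|x] [[[e'|]|]|x'] //=; try by case=> ->.
  - move=> _; congr inr; apply: lab_inj; apply: val_inj; rewrite lab_ext_at /=.
    by rewrite -[sval _]/(val _) -nat_tr_lab -[tr_lab _]/(lab (side_tr S a') _) lab_ext_at e2.
  - move=> _; congr inr; apply: lab_inj; apply: val_inj; rewrite lab_ext_at /=.
    by rewrite -[sval _]/(val _) -nat_tr_lab -[tr_lab _]/(lab (side_tr S i) _) lab_ext_at e1.
  move=> exx; congr inr; apply: lab_inj; apply: val_inj.
  rewrite -[sval (sval x)]/(val (val x)) -[sval (sval x')]/(val (val x')) /=.
  have -> : lab S (sval (sval x)) = bump i (bump i' (tr_lab x)) :> nat.
    by rewrite nat_tr_lab -[lab (side_tr S i) _]/(tr_lab _) nat_tr_lab.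
  have -> : lab S (sval (sval x')) = bump a' (bump a (tr_lab x')) :> nat.
    by rewrite nat_tr_lab -[lab (side_tr S a') _]/(tr_lab _) nat_tr_lab.
  by rewrite exx; move: e1 e2; rewrite /bump; lia.
apply: simH => // [h h' /hR /= ->//|h1 h1' h2 h2' /hR r1 /hR r2 _ /=].
by rewrite r1 r2.
Qed.

Lemma sim_tr_relabel (V E : finType) n (S : side V E n.+1)
    (f : 'I_n.+1 -> 'I_n.+1) (fB : bijective f) (i i' : 'I_n.+1)
    (g : 'I_n -> 'I_n) (gB : bijective g) :
  f i' = i -> (forall r, lift i (g r) = f (lift i' r)) ->
  sim id id (side_tr (relabel fB S) i) (relabel gB (side_tr S i')).
Proof.
move=> fi gE.
have hR h h' : hrel id (S := side_tr (relabel fB S) i)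
      (S' := relabel gB (side_tr S i')) h h' ->
    tr_half (h : option E + ext (side_tr (relabel fB S) i))
    = tr_half (h' : option E + ext (side_tr S i')) :> E + ext S.
  case: h h' => [[e|]|x] [[e'|]|x'] //=; try by case=> ->.
  - move=> _; congr inr; apply/(@lab_inj _ _ _ S)/(bij_inj fB).
    by rewrite -[LHS]/(lab (relabel fB S) _) !lab_ext_at fi.
  move/val_inj => exx; congr inr; apply/(@lab_inj _ _ _ S)/(bij_inj fB).
  rewrite -[LHS]/(lab (relabel fB S) (val x)) -lift_tr_lab exx gE.
  by rewrite lift_tr_lab.
apply: simH => // [h h' /hR /= ->//|h1 h1' h2 h2' /hR r1 /hR r2 _ /=].
by rewrite r1 r2.
Qed.

Definition opt_suml A B C (f : A -> B + C) (x : option A) : option B + C :=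
  match x with
  | None => inl None
  | Some a => match f a with inl b => inl (Some b) | inr c => inr c end
  end.

Definition opt_sumr A B C (f : A -> B + C) (x : option A) : B + option C :=
  match x with
  | None => inr None
  | Some a => match f a with inl b => inl b | inr c => inr (Some c) end
  end.

Lemma opt_suml_bij A B C (f : A -> B + C) :
  bijective f -> bijective (opt_suml f).
Proof.
case=> g fK gK; exists (fun x => match x with inl None => None
  | inl (Some b) => Some (g (inl b)) | inr c => Some (g (inr c)) end).
  by case=> [a|] //=; rewrite -{2}(fK a); case: (f a).
by case=> [[b|]|c] //=; rewrite gK.
Qed.

Lemma opt_sumr_bij A B C (f : A -> B + C) :
  bijective f -> bijective (opt_sumr f).
Proof.
case=> g fK gK; exists (fun x => match x with inr None => None
  | inr (Some b) => Some (g (inr b)) | inl c => Some (g (inl c)) end).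
  by case=> [a|] //=; rewrite -{2}(fK a); case: (f a).
by case=> [b|[c|]] //=; rewrite gK.
Qed.

Lemma sim_tr_catl (V E V1 E1 V2 E2 : finType) n n' (C : side V E (n + n').+1)
    (S : side V1 E1 n.+1) (S' : side V2 E2 n') (i : 'I_(n + n').+1)
    (i1 : 'I_n.+1) (fV : V -> V1 + V2) (fE : E -> E1 + E2) : i = i1 :> nat ->
  sim fV fE C (side_cat S S') ->
  sim fV (opt_suml fE) (side_tr C i) (side_cat (side_tr S i1) S').
Proof.
move=> ei /simE[_ fA fO].
pose emb (h : (option E1 + E2) + (tr_ext S i1 + ext S')) :
    (E1 + E2) + (ext S + ext S') :=
  match h with
  | inl (inl None) => inr (inl (ext_at S i1))
  | inl (inl (Some e)) => inl (inl e)
  | inl (inr e) => inl (inr e)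
  | inr (inl x) => inr (inl (val x))
  | inr (inr x) => inr (inr x)
  end.
have hA h : att (side_cat (side_tr S i1) S') h = att (side_cat S S') (emb h).
  by case: h => [[[e|]|e]|[x|x]].
have hO h1 h2 : ord (side_cat (side_tr S i1) S') h1 h2
    = ord (side_cat S S') (emb h1) (emb h2).
  by case: h1 h2 => [[[e|]|e]|[x|x]] [[[e'|]|e']|[x'|x']].
have hR (h : option E + ext (side_tr C i))
    (h' : (option E1 + E2) + (tr_ext S i1 + ext S')) :
    hrel (opt_suml fE) (S := side_tr C i)
      (S' := side_cat (side_tr S i1) S') h h' ->
    hrel fE (S := C) (S' := side_cat S S') (tr_half h) (emb h').
  case: h h' => [[e|]|x] [e'|x'] //=.
  - by move=> ->; case: (fE e).
  - by move=> -> /=; rewrite !lab_ext_at.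
  - move=> exx; rewrite -nat_tr_lab exx.
    case: x' {exx} => x' /=; first by rewrite ei nat_tr_lab.
    by rewrite /bump ei; have := ltn_ord i1; lia.
apply: simH => // [h h' /hR/fA|h1 h1' h2 h2' /hR r1 /hR r2 e].
  by rewrite hA.
by rewrite hO; apply: fO r1 r2 e.
Qed.

Lemma sim_tr_catr (V E V1 E1 V2 E2 : finType) n n' (C : side V E (n + n').+1)
    (S : side V1 E1 n) (S' : side V2 E2 n'.+1) (i : 'I_(n + n').+1)
    (i1 : 'I_n'.+1) (fV : V -> V1 + V2) (fE : E -> E1 + E2) :
  i = n + i1 :> nat -> sim fV fE C (side_cat S S') ->
  sim fV (opt_sumr fE) (side_tr C i) (side_cat S (side_tr S' i1)).
Proof.
move=> ei /simE[_ fA fO].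
pose emb (h : (E1 + option E2) + (ext S + tr_ext S' i1)) :
    (E1 + E2) + (ext S + ext S') :=
  match h with
  | inl (inr None) => inr (inr (ext_at S' i1))
  | inl (inr (Some e)) => inl (inr e)
  | inl (inl e) => inl (inl e)
  | inr (inr x) => inr (inr (val x))
  | inr (inl x) => inr (inl x)
  end.
have hA h : att (side_cat S (side_tr S' i1)) h = att (side_cat S S') (emb h).
  by case: h => [[e|[e|]]|[x|x]].
have hO h1 h2 : ord (side_cat S (side_tr S' i1)) h1 h2
    = ord (side_cat S S') (emb h1) (emb h2).
  by case: h1 h2 => [[e|[e|]]|[x|x]] [[e'|[e'|]]|[x'|x']].
have hR (h : option E + ext (side_tr C i))
    (h' : (E1 + option E2) + (ext S + tr_ext S' i1)) :
    hrel (opt_sumr fE) (S := side_tr C i)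
      (S' := side_cat S (side_tr S' i1)) h h' ->
    hrel fE (S := C) (S' := side_cat S S') (tr_half h) (emb h').
  case: h h' => [[e|]|x] [e'|x'] //=.
  - by move=> ->; case: (fE e).
  - by move=> -> /=; rewrite !lab_ext_at.
  - move=> exx; rewrite -nat_tr_lab exx.
    case: x' {exx} => x' /=; last by rewrite ei bumpDl nat_tr_lab.
    by rewrite /bump ei; have := ltn_ord (lab S x'); lia.
apply: simH => // [h h' /hR/fA|h1 h1' h2 h2' /hR r1 /hR r2 e].
  by rewrite hA.
by rewrite hO; apply: fO r1 r2 e.
Qed.

End SideAxioms.

Section GraphAxioms.
Variable P : nat -> nat -> Type.

Lemma id_bij A : bijective (@id A).
Proof. exact: (Bijective (frefl id) (frefl id)). Qed.

Lemma sim_relabel2 (V E : finType) n (S : side V E n) (f f' g : 'I_n -> 'I_n)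
    (fB : bijective f) (fB' : bijective f') (gB : bijective g) :
  (forall i, f' (f i) = g i) ->
  sim id id (relabel fB' (relabel fB S)) (relabel gB S).
Proof.
by move=> e; split=> //; exists id; split=> [x|[]|[?|?] []] //=; rewrite e.
Qed.

Ltac same_tac :=
  repeat (apply: same_trans (same_castl _ _ _) _); apply: same_sym;
  repeat (apply: same_trans (same_castl _ _ _) _); exact: same_refl.

Lemma hiso_lact1 k l (G : graph P k l) : hiso (graph_lact 1%g G) G.
Proof.
exists id, id; split; try exact: id_bij; try exact: sim_refl.
- by apply: sim_relabel_id => [i|]; [rewrite perm1 | apply: sim_refl].
- by move=> v; apply: same_refl.
Qed.

Lemma hiso_lactM k l (s s' : 'S_l) (G : graph P k l) :
  hiso (graph_lact s (graph_lact s' G)) (graph_lact (pcomp s s') G).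
Proof.
exists id, id; split; try exact: id_bij; try exact: sim_refl.
- by apply: sim_relabel2 => i; rewrite pcompE.
- by move=> v; apply: same_refl.
Qed.

Lemma hiso_ract1 k l (G : graph P k l) : hiso (graph_ract G 1%g) G.
Proof.
exists id, id; split; try exact: id_bij; try exact: sim_refl.
- by apply: sim_relabel_id => [i|]; [rewrite invg1 perm1 | apply: sim_refl].
- by move=> v; apply: same_refl.
Qed.

Lemma hiso_ractM k l (G : graph P k l) (t t' : 'S_k) :
  hiso (graph_ract (graph_ract G t) t') (graph_ract G (pcomp t t')).
Proof.
exists id, id; split; try exact: id_bij; try exact: sim_refl.
- by apply: sim_relabel2 => i; rewrite /pcomp invMg permM.
- by move=> v; apply: same_refl.
Qed.

Lemma hiso_catA k l k' l' k'' l'' (G : graph P k l) (G' : graph P k' l')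
    (G'' : graph P k'' l'') :
  hiso (graph_cat G (graph_cat G' G'')) (graph_cat (graph_cat G G') G'').
Proof.
exists (@sum_assoc _ _ _), (@sum_assoc _ _ _).
split; try exact: sum_assoc_bij; try exact: sim_catA.
by case=> [v|[v|v]] /=; same_tac.
Qed.

Lemma hiso_cat1l k l (G : graph P k l) : hiso (graph_cat (graph_one P) G) G.
Proof.
exists (@void_inl _), (@void_inl _).
split; try exact: void_inl_bij; try exact: sim_cat1l.
by case=> [[]|v] /=; same_tac.
Qed.

Lemma hiso_cat1r k l (G : graph P k l) : hiso (graph_cat G (graph_one P)) G.
Proof.
exists (@void_inr _), (@void_inr _).
split; try exact: void_inr_bij; try exact: sim_cat1r.
by case=> [v|[]] /=; same_tac.
Qed.

Lemma tens_perm_l m n (s : 'S_m) (t : 'S_n) i :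
  tens_perm s t (lshift n i) = lshift n (s i).
Proof. by rewrite permE /tens_fun split_lshift. Qed.

Lemma tens_perm_r m n (s : 'S_m) (t : 'S_n) i :
  tens_perm s t (rshift m i) = rshift m (t i).
Proof. by rewrite permE /tens_fun split_rshift. Qed.

Lemma hiso_cat_act k l k' l' (s : 'S_l) (G : graph P k l) (t : 'S_k)
    (s' : 'S_l') (G' : graph P k' l') (t' : 'S_k') :
  hiso (graph_cat (graph_ract (graph_lact s G) t)
                  (graph_ract (graph_lact s' G') t'))
       (graph_ract (graph_lact (tens_perm s s') (graph_cat G G'))
                   (tens_perm t t')).
Proof.
exists id, id; split; try exact: id_bij.
- apply: sim_cat_relabel => i; apply: (canLR (permK _)).
    by rewrite tens_perm_l permKV.
  by rewrite tens_perm_r permKV.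
- by apply: sim_cat_relabel => i; rewrite ?tens_perm_l ?tens_perm_r.
- by case=> v /=; same_tac.
Qed.

Lemma hiso_catC k l k' l' (G : graph P k l) (G' : graph P k' l') :
  hiso (graph_ract (graph_lact (swap_perm l l') (graph_cat G G'))
                   (swap_perm k k')^-1%g) (graph_cat G' G).
Proof.
exists (@sum_swap _ _), (@sum_swap _ _).
split; try exact: sum_swap_bij.
- by apply: sim_catC => i; rewrite invgK permE.
- by apply: sim_catC => i; rewrite permE.
- by case=> v /=; same_tac.
Qed.

Lemma hiso_trtr k l (G : graph P k.+2 l.+2) (i a' : 'I_k.+2) (i' a : 'I_k.+1)
    (j b' : 'I_l.+2) (j' b : 'I_l.+1) :
  bump i i' = a' -> bump a' a = i -> bump j j' = b' -> bump b' b = j ->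
  hiso (graph_tr i' j' (graph_tr i j G)) (graph_tr a b (graph_tr a' b' G)).
Proof.
move=> e1 e2 e3 e4; exists id, (@opt_swap _).
split; try exact: id_bij; try exact: opt_swap_bij; try exact: sim_trtr.
by move=> v /=; same_tac.
Qed.

Lemma hiso_tr_act k l (i : 'I_k.+1) (j : 'I_l.+1) (s : 'S_l.+1)
    (G : graph P k.+1 l.+1) (t : 'S_k.+1) :
  hiso (graph_tr i j (graph_ract (graph_lact s G) t))
       (graph_ract (graph_lact (del_perm j s)
          (graph_tr (t i) ((s^-1)%g j) G)) (del_perm (t i) t)).
Proof.
exists id, id; split; try exact: id_bij.
- apply: sim_tr_relabel => [|r]; first by rewrite permK.
  apply/esym/(canLR (permK _)); set q := del_perm _ _.
  by rewrite -{1}(permKV q r) [q _]permE lift_del_fun permK.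
- by apply: sim_tr_relabel => [|r]; rewrite ?permKV // permE lift_del_fun.
- by move=> v /=; same_tac.
Qed.

Lemma hiso_tr_catl k l k' l' (C : graph P (k + k').+1 (l + l').+1)
    (G : graph P k.+1 l.+1) (G' : graph P k' l') (i1 : 'I_k.+1) (j1 : 'I_l.+1)
    (i : 'I_(k + k').+1) (j : 'I_(l + l').+1) : i = i1 :> nat -> j = j1 :> nat ->
  hiso C (graph_cat G G') ->
  hiso (graph_tr i j C) (graph_cat (graph_tr i1 j1 G) G').
Proof.
move=> ei ej [fV [fE [fVB fEB si so sd]]].
exists fV, (opt_suml fE).
split; try exact: opt_suml_bij; try exact: sim_tr_catl; first by [].
move=> v; apply: same_trans (same_castl _ _ _) _.
apply: same_trans (sd v) _; case: (fV v) => w /=; same_tac.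
Qed.

Lemma hiso_tr_catr k l k' l' (C : graph P (k + k').+1 (l + l').+1)
    (G : graph P k l) (G' : graph P k'.+1 l'.+1)
    (i1 : 'I_k'.+1) (j1 : 'I_l'.+1)
    (i : 'I_(k + k').+1) (j : 'I_(l + l').+1) :
  i = k + i1 :> nat -> j = l + j1 :> nat ->
  hiso C (graph_cat G G') ->
  hiso (graph_tr i j C) (graph_cat G (graph_tr i1 j1 G')).
Proof.
move=> ei ej [fV [fE [fVB fEB si so sd]]].
exists fV, (opt_sumr fE).
split; try exact: opt_sumr_bij; try exact: sim_tr_catr; first by [].
move=> v; apply: same_trans (same_castl _ _ _) _.
apply: same_trans (sd v) _; case: (fV v) => w /=; same_tac.
Qed.

Definition gc_lact k l (s : 'S_l) (C : graph_class P k l) :=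
  cls (graph_lact s (rep C)).

Definition gc_ract k l (C : graph_class P k l) (t : 'S_k) :=
  cls (graph_ract (rep C) t).

Definition gc_cat k l k' l' (C : graph_class P k l) (D : graph_class P k' l') :=
  cls (graph_cat (rep C) (rep D)).

Definition gc_tr k l (i : 'I_k.+1) (j : 'I_l.+1) (C : graph_class P k.+1 l.+1) :=
  cls (graph_tr i j (rep C)).

Lemma gc_lactE k l (s : 'S_l) (G : graph P k l) :
  gc_lact s (cls G) = cls (graph_lact s G).
Proof. exact/clsE/hiso_lact/rep_cls. Qed.

Lemma gc_ractE k l (G : graph P k l) (t : 'S_k) :
  gc_ract (cls G) t = cls (graph_ract G t).
Proof. exact/clsE/hiso_ract/rep_cls. Qed.

Lemma gc_catE k l k' l' (G : graph P k l) (G' : graph P k' l') :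
  gc_cat (cls G) (cls G') = cls (graph_cat G G').
Proof. by apply/clsE/hiso_cat; apply: rep_cls. Qed.

Lemma gc_trE k l (i : 'I_k.+1) (j : 'I_l.+1) (G : graph P k.+1 l.+1) :
  gc_tr i j (cls G) = cls (graph_tr i j G).
Proof. by apply/clsE/hiso_tr => //; apply: rep_cls. Qed.

Lemma graph_classP k l (C : graph_class P k l) : exists G, C = cls G.
Proof. by exists (rep C); rewrite cls_rep. Qed.

Definition gcE := (castT_cls, gc_lactE, gc_ractE, gc_catE, gc_trE).

Lemma gc_lact1 k l (C : graph_class P k l) : gc_lact 1%g C = C.
Proof.
have [G ->] := graph_classP C; rewrite gcE; exact/clsE/hiso_lact1.
Qed.

Lemma gc_lactM k l (s s' : 'S_l) (C : graph_class P k l) :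
  gc_lact s (gc_lact s' C) = gc_lact (pcomp s s') C.
Proof.
have [G ->] := graph_classP C; rewrite !gcE; exact/clsE/hiso_lactM.
Qed.

Lemma gc_ract1 k l (C : graph_class P k l) : gc_ract C 1%g = C.
Proof.
have [G ->] := graph_classP C; rewrite gcE; exact/clsE/hiso_ract1.
Qed.

Lemma gc_ractM k l (C : graph_class P k l) (t t' : 'S_k) :
  gc_ract (gc_ract C t) t' = gc_ract C (pcomp t t').
Proof.
have [G ->] := graph_classP C; rewrite !gcE; exact/clsE/hiso_ractM.
Qed.

Lemma gc_lractC k l (s : 'S_l) (C : graph_class P k l) (t : 'S_k) :
  gc_ract (gc_lact s C) t = gc_lact s (gc_ract C t).
Proof.
by have [G ->] := graph_classP C; rewrite !gcE.
Qed.

Lemma gc_catA k l k' l' k'' l'' (C : graph_class P k l)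
    (C' : graph_class P k' l') (C'' : graph_class P k'' l'') :
  castT (addnA k k' k'') (addnA l l' l'') (gc_cat C (gc_cat C' C''))
    = gc_cat (gc_cat C C') C''.
Proof.
have [G ->] := graph_classP C; have [G' ->] := graph_classP C'.
have [G'' ->] := graph_classP C''; rewrite !gcE; apply: clsE.
exact: hiso_trans (hiso_sym (hiso_castr _ _ _)) (hiso_catA _ _ _).
Qed.

Lemma gc_cat1l k l (C : graph_class P k l) :
  castT (add0n k) (add0n l) (gc_cat (cls (graph_one P)) C) = C.
Proof.
have [G ->] := graph_classP C; rewrite !gcE; apply: clsE.
exact: hiso_trans (hiso_sym (hiso_castr _ _ _)) (hiso_cat1l _).
Qed.

Lemma gc_cat1r k l (C : graph_class P k l) :
  castT (addn0 k) (addn0 l) (gc_cat C (cls (graph_one P))) = C.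
Proof.
have [G ->] := graph_classP C; rewrite !gcE; apply: clsE.
exact: hiso_trans (hiso_sym (hiso_castr _ _ _)) (hiso_cat1r _).
Qed.

Lemma gc_cat_act k l k' l' (s : 'S_l) (C : graph_class P k l) (t : 'S_k)
    (s' : 'S_l') (C' : graph_class P k' l') (t' : 'S_k') :
  gc_cat (gc_ract (gc_lact s C) t) (gc_ract (gc_lact s' C') t')
    = gc_ract (gc_lact (tens_perm s s') (gc_cat C C')) (tens_perm t t').
Proof.
have [G ->] := graph_classP C; have [G' ->] := graph_classP C'.
rewrite !gcE; exact/clsE/hiso_cat_act.
Qed.

Lemma gc_catC k l k' l' (C : graph_class P k l) (C' : graph_class P k' l') :
  gc_lact (swap_perm l l') (gc_cat C C')
    = gc_ract (castT (addnC k' k) (addnC l' l) (gc_cat C' C)) (swap_perm k k').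
Proof.
have [G ->] := graph_classP C; have [G' ->] := graph_classP C'.
rewrite !gcE -[LHS]gc_ract1 -(mulgV (swap_perm k k'))%g.
rewrite -[(_ * _)%g]/(pcomp _ _) -gc_ractM !gcE.
apply/clsE/hiso_ract; exact: hiso_trans (hiso_catC _ _) (hiso_castr _ _ _).
Qed.

Lemma gc_trC k l (C : graph_class P k.+2 l.+2) (i a' : 'I_k.+2)
    (i' a : 'I_k.+1) (j b' : 'I_l.+2) (j' b : 'I_l.+1) :
  bump i i' = a' -> bump a' a = i -> bump j j' = b' -> bump b' b = j ->
  gc_tr i' j' (gc_tr i j C) = gc_tr a b (gc_tr a' b' C).
Proof.
have [G ->] := graph_classP C => *; rewrite !gcE; exact/clsE/hiso_trtr.
Qed.

Lemma bump_ltl n (i : 'I_n.+2) (i' : 'I_n.+1) : i' < i ->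
  bump i i' = (inord i' : 'I_n.+2)
  /\ bump (inord i' : 'I_n.+2) (inord i.-1 : 'I_n.+1) = i.
Proof.
move=> lt; have := ltn_ord i; have := ltn_ord i' => h h'.
by rewrite !inordK /bump; lia.
Qed.

Lemma bump_geq n (i : 'I_n.+2) (i' : 'I_n.+1) : i <= i' ->
  bump i i' = (inord i'.+1 : 'I_n.+2)
  /\ bump (inord i'.+1 : 'I_n.+2) (inord i : 'I_n.+1) = i.
Proof.
move=> lt; have := ltn_ord i; have := ltn_ord i' => h h'.
by rewrite !inordK /bump; lia.
Qed.

Lemma gc_tr_act k l (i : 'I_k.+1) (j : 'I_l.+1) (s : 'S_l.+1)
    (C : graph_class P k.+1 l.+1) (t : 'S_k.+1) :
  gc_tr i j (gc_ract (gc_lact s C) t)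
    = gc_ract (gc_lact (del_perm j s) (gc_tr (t i) ((s^-1)%g j) C))
              (del_perm (t i) t).
Proof.
have [G ->] := graph_classP C; rewrite !gcE; exact/clsE/hiso_tr_act.
Qed.

Lemma gc_tr_catl k l k' l' (C : graph_class P k.+1 l.+1)
    (C' : graph_class P k' l') (i : 'I_k.+1) (j : 'I_l.+1) :
  @gc_tr (k + k') (l + l') (lshift k' i) (lshift l' j) (gc_cat C C')
    = gc_cat (gc_tr i j C) C'.
Proof.
have [G ->] := graph_classP C; have [G' ->] := graph_classP C'.
rewrite !gcE; apply/clsE/hiso_tr_catl => //; exact: hiso_refl.
Qed.

Lemma gc_tr_catr k l k' l' (C : graph_class P k l)
    (C' : graph_class P k'.+1 l'.+1) (i : 'I_k'.+1) (j : 'I_l'.+1) :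
  gc_tr (cast_ord (addnS k k') (rshift k i)) (cast_ord (addnS l l') (rshift l j))
        (castT (addnS k k') (addnS l l') (gc_cat C C'))
    = gc_cat C (gc_tr i j C').
Proof.
have [G ->] := graph_classP C; have [G' ->] := graph_classP C'.
rewrite !gcE; apply/clsE/hiso_tr_catr => //; exact/hiso_sym/hiso_castr.
Qed.

End GraphAxioms.

Definition solCGr (P : nat -> nat -> Type) : trap.
Proof.
refine (@Trap (graph_class P) (@gc_lact P) (@gc_ract P) (@gc_cat P)
  (cls (graph_one P)) (@gc_tr P) (@gc_lact1 P) (@gc_lactM P) (@gc_ract1 P)
  (@gc_ractM P) (@gc_lractC P) (@gc_catA P) (@gc_cat1l P) (@gc_cat1r P)
  (@gc_cat_act P) (@gc_catC P) _ _ _ _ (@gc_tr_act P) (@gc_tr_catl P)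
  (@gc_tr_catr P)).
- by move=> k l i j i' j' C /bump_ltl[? ?] /bump_ltl[? ?]; apply: gc_trC.
- by move=> k l i j i' j' C /bump_geq[? ?] /bump_ltl[? ?]; apply: gc_trC.
- by move=> k l i j i' j' C /bump_ltl[? ?] /bump_geq[? ?]; apply: gc_trC.
- by move=> k l i j i' j' C /bump_geq[? ?] /bump_geq[? ?]; apply: gc_trC.
Defined.

Definition corolla (P : trap) k l (p : P k l) : solCGr P k l :=
  cls (graph_corolla p).

(* The universal property characterizing the canonical morphism solCGr(P) -> P. *)
Definition is_amplitude (P : trap) (Phi : trap_morphism (solCGr P) P) : Prop :=
  forall k l (p : P k l), Phi k l (corolla p) = p.

(* Main.v *)
Require Import Defs.
From mathcomp Require Import all_boot.

(** The amplitude map is a morphism of TRAPs, so horizontal concatenation is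
    preserved by definition.  The vertical concatenation is not a primitive
    operation of a TRAP: it is a composite of partial traces applied to a
    horizontal concatenation, transported along equalities of arities.  Every
    ingredient commutes with morphisms (castT_morphism, vtrace_morphism), hence
    any morphism of TRAPs preserves it (vcat_morphism); the claim is the case of
    the morphism from solar graphs to P. *)

Section Morphism.
Variables (P Q : trap) (phi : trap_morphism P Q).

Lemma castT_morphism k k' l l' (ek : k = k') (el : l = l') (p : P k l) :
  phi k' l' (castT ek el p) = castT ek el (phi k l p).
Proof. by subst. Qed.

Lemma vtrace_morphism k m r (p : P (k + r) (r + m)) :
  phi k m (vtrace p) = vtrace (phi (k + r) (r + m) p).
Proof.
elim: r p => [|r IHr] p /=; first exact: castT_morphism.
by rewrite IHr tmap_ptrace castT_morphism.
Qed.

Lemma vcat_morphism k l m (q : P l m) (p : P k l) :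
  phi k m (vcat q p) = vcat (phi l m q) (phi k l p).
Proof. by rewrite /vcat vtrace_morphism tmap_hcat. Qed.

End Morphism.

Theorem proposition4p3p2 (P : trap) (Phi : trap_morphism (solCGr P) P)
    (hPhi : is_amplitude Phi) :
  (forall (k l k' l' : nat) (G1 : solCGr P k l) (G2 : solCGr P k' l'),
     Phi (k + k') (l + l') (hcat G1 G2) = hcat (Phi k l G1) (Phi k' l' G2)) /\
  (forall (k l m : nat) (G1 : solCGr P l m) (G2 : solCGr P k l),
     Phi k m (vcat G1 G2) = vcat (Phi l m G1) (Phi k l G2)).
Proof.
split=> [k l k' l' G1 G2|k l m G1 G2]; first exact: tmap_hcat.
exact: vcat_morphism.
Qed.
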